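(* Let $(\mathbf x,\mathbf s)$ and $(\tilde{\mathbf x},\tilde{\mathbf s})$ be two centrally symmetric finite electorates in $\mathbb R^K$, with centers $\mu$ and $\tilde\mu$. Hold $\nu$ and $\phi$ fixed, let $\nu$ be strictly concave on $[0,1]$, and suppose that the wide-support condition holds on a common coordinate rectangle $D^\cup\subset\mathbb R^K$ containing both centered supports $\{x_i-\mu\}_i$ and $\{\tilde x_i-\tilde\mu\}_i$, for every voter type in either electorate: $\phi>\sup_{a,b\in D^\cup}\big|\|b-y\|^2-\|a-y\|^2\big|$ for every $y$ in either centered support. Fix a party-preferred equilibrium $x^\star=(x_A^\star,x_B^\star)$ of $(\mathbf x,\mathbf s)$ and let $q^\star=x_A^\star-x_B^\star$. If $(\tilde{\mathbf x},\tilde{\mathbf s})$ is a $q^\star$-spread of $(\mathbf x,\mathbf s)$, then $$\hat V_p(\tilde{\mathbf x},\tilde{\mathbf s})>\hat V_p(\mathbf x,\mathbf s),\qquad p=A,B,$$ where $\hat V_p$ denotes party $p$'s payoff at a party-preferred equilibrium.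
   Context: $K\ge2$. A finite electorate $(\mathbf x,\mathbf s)$ consists of $N\ge2$ voter types with distinct bliss points $x_i\in\mathbb R^K$ and shares $s_i>0$, $\sum_is_i=1$. It is centrally symmetric with center $\mu$ if for every $i$ there is $\bar i$ with $x_{\bar i}=2\mu-x_i$, $s_{\bar i}=s_i$. Parties $A,B$ simultaneously choose platforms in $\mathbb R^K$. Let $\Delta_i(x_A,x_B)=\|x_B-x_i\|^2-\|x_A-x_i\|^2$; a common shock $\epsilon$ is uniform on $[-\phi,\phi]$; $S_A(\epsilon)=\sum_is_i\mathbf 1\{\Delta_i\ge\epsilon\}$, $S_B=1-S_A$. The power rule $\rho:[0,1]\to\mathbb R$ is strictly increasing with $\rho(s)+\rho(1-s)=\bar\rho$ for all $s$; $U:[\rho(0),\rho(1)]\to\mathbb R$ is continuous, strictly increasing, strictly concave; $\nu=U\circ\rho$ with $\nu(1)-\nu(0)=1$. Payoffs are $V_p=\mathbb E_\epsilon[\nu(S_p(\epsilon))]$. A pure-strategy Nash equilibrium is party-preferred if it maximizes each party's payoff among all pure-strategy Nash equilibria; under the assumptions of the claim these exist, and $\hat V_p$ is the resulting (maximal) equilibrium payoff of party $p$. Spread (one-dimensional finite distributions): split any mass at the median (midpoint of the median set) between two half-electorates (weakly left and weakly right of the median) so that each has mass $\frac12$; normalize each to unit mass, giving left and right distributions. A distribution $\mathcal G'$ is a spread of $\mathcal G$ if the left distribution of $\mathcal G$ first-order stochastically dominates that of $\mathcal G'$ and the right distribution of $\mathcal G'$ first-order stochastically dominates that of $\mathcal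 G$ (weak dominance, pointwise ordering of cdfs), with at least one relation strict (the two distributions differ). $q$-spread: for $q\in\mathbb R^K$, a centrally symmetric finite electorate $(\tilde{\mathbf x},\tilde{\mathbf s})$ with center $\tilde\mu$ is a $q$-spread of $(\mathbf x,\mathbf s)$ with center $\mu$ if the projected distribution with atoms $(\tilde x_i-\tilde\mu)^\top q$ of mass $\tilde s_i$ is a spread of the projected distribution with atoms $(x_i-\mu)^\top q$ of mass $s_i$. *)

(* Defs.v *)
(* MathComp / MathComp-Analysis. *)
From mathcomp Require Import all_boot all_order all_algebra.
From mathcomp Require Import all_classical all_reals all_analysis.
Import Order.TTheory GRing.Theory Num.Theory.
Import numFieldNormedType.Exports.

Set Implicit Arguments.
Unset Strict Implicit.
Unset Printing Implicit Defensive.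

Local Open Scope classical_set_scope.
Local Open Scope ring_scope.

(* The library norm on row vectors is the sup norm, so the Euclidean inner
   product and squared norm are spelled out. *)
Definition dot (R : realType) (K : nat) (u v : 'rV[R]_K) : R :=
  \sum_(k < K) u ord0 k * v ord0 k.

Definition sqnorm (R : realType) (K : nat) (u : 'rV[R]_K) : R := dot u u.

Definition strictly_concave_on (R : realType) (a b : R) (f : R -> R) : Prop :=
  forall x y t : R, x \in `[a, b] -> y \in `[a, b] -> x != y -> 0 < t < 1 ->
    t * f x + (1 - t) * f y < f (t * x + (1 - t) * y).

Definition strictly_increasing_on (R : realType) (a b : R) (f : R -> R) : Prop :=
  {in `[a, b] &, forall x y : R, x < y -> f x < f y}.

Record electorate (R : realType) (K : nat) := Electorate {
  ntypes : nat;
  bliss : 'I_ntypes -> 'rV[R]_K;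
  share : 'I_ntypes -> R;
  ntypes_ge2 : (2 <= ntypes)%N;
  bliss_inj : injective bliss;
  share_gt0 : forall i, 0 < share i;
  share_sum1 : \sum_i share i = 1 }.

Arguments bliss {R K} e i : rename.
Arguments share {R K} e i : rename.

Definition centrally_symmetric (R : realType) (K : nat)
    (e : electorate R K) (mu : 'rV[R]_K) : Prop :=
  forall i, exists j,
    bliss e j = 2%:R *: mu - bliss e i /\ share e j = share e i.

Inductive party := PartyA | PartyB.

(* The first component is the platform of A, the second one that of B. *)
Definition profile (R : realType) (K : nat) : Type :=
  ('rV[R]_K * 'rV[R]_K)%type.

Definition advantage (R : realType) (K : nat) (e : electorate R K)
    (x : profile R K) (i : 'I_(ntypes e)) : R :=
  sqnorm (x.2 - bliss e i) - sqnorm (x.1 - bliss e i).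

Definition vote_share (R : realType) (K : nat) (e : electorate R K)
    (x : profile R K) (p : party) (eps : R) : R :=
  let SA := \sum_(i | eps <= advantage x i) share e i in
  match p with PartyA => SA | PartyB => 1 - SA end.

Definition shock (R : realType) (phi : R) (phi_gt0 : 0 < phi) :
    probability (measurableTypeR R) R :=
  uniform_prob (gtrN phi_gt0).

(* An extended real because the library's expectation is. *)
Definition payoff (R : realType) (K : nat) (phi : R) (phi_gt0 : 0 < phi)
    (nu : R -> R) (e : electorate R K) (p : party) (x : profile R K) : \bar R :=
  ('E_(shock phi_gt0) [fun eps => nu (vote_share e x p eps)])%E.

Definition nash (R : realType) (K : nat) (phi : R) (phi_gt0 : 0 < phi)
    (nu : R -> R) (e : electorate R K) (x : profile R K) : Prop :=
  (forall y, payoff phi_gt0 nu e PartyA (y, x.2)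
             <= payoff phi_gt0 nu e PartyA x)%E /\
  (forall y, payoff phi_gt0 nu e PartyB (x.1, y)
             <= payoff phi_gt0 nu e PartyB x)%E.

Definition party_preferred (R : realType) (K : nat) (phi : R)
    (phi_gt0 : 0 < phi) (nu : R -> R) (e : electorate R K)
    (x : profile R K) : Prop :=
  nash phi_gt0 nu e x /\
  forall y, nash phi_gt0 nu e y ->
    forall p, (payoff phi_gt0 nu e p y <= payoff phi_gt0 nu e p x)%E.

(* All party-preferred equilibria give a party the same payoff, so the
   supremum is over a singleton when such an equilibrium exists; it is -oo
   otherwise. In particular [u < Vhat _ _ e p] entails that the electorate [e]
   has a party-preferred equilibrium. *)
Definition Vhat (R : realType) (K : nat) (phi : R) (phi_gt0 : 0 < phi)
    (nu : R -> R) (e : electorate R K) (p : party) : \bar R :=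
  ereal_sup [set payoff phi_gt0 nu e p x | x in party_preferred phi_gt0 nu e].

Definition coordinate_rectangle (R : realType) (K : nat)
    (D : set 'rV[R]_K) : Prop :=
  exists I : 'I_K -> interval R, D = [set z | forall k, z ord0 k \in I k].

(* The supremum is taken in the extended reals: the real-valued [sup] of an
   unbounded set is 0, which would make the condition spuriously true. *)
Definition wide_support (R : realType) (K : nat) (phi : R)
    (D : set 'rV[R]_K) (e : electorate R K) (mu : 'rV[R]_K) : Prop :=
  forall i, let y := bliss e i - mu in
    (ereal_sup [set (`|sqnorm (ab.2 - y) - sqnorm (ab.1 - y)|)%:E
               | ab in D `*` D] < phi%:E)%E.

(* One-dimensional finite distributions: lists of pairs (atom, mass), in which
   an atom may be repeated. *)
Definition fdistr (R : realType) : Type := seq (R * R).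

Definition mass (R : realType) (G : fdistr R) (P : pred R) : R :=
  \sum_(a <- G | P a.1) a.2.

Definition cdf_of (R : realType) (G : fdistr R) (z : R) : R :=
  mass G (fun a => a <= z).

Definition median_set (R : realType) (G : fdistr R) : set R :=
  [set m | 2^-1 <= mass G (fun a => a <= m) /\
           2^-1 <= mass G (fun a => m <= a)].

Definition median_of (R : realType) (G : fdistr R) : R :=
  (inf (median_set G) + sup (median_set G)) / 2%:R.

(* Each half consists of the atoms strictly on its side of the median m and of
   an atom at m carrying what its side lacks to reach 1/2; the factor 2
   normalizes the half to unit mass. *)
Definition left_distr (R : realType) (G : fdistr R) : fdistr R :=
  let m := median_of G in
  (m, 2%:R * (2^-1 - mass G (fun a => a < m)))
    :: [seq (a.1, 2%:R * a.2) | a <- G & a.1 < m].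

Definition right_distr (R : realType) (G : fdistr R) : fdistr R :=
  let m := median_of G in
  (m, 2%:R * (2^-1 - mass G (fun a => m < a)))
    :: [seq (a.1, 2%:R * a.2) | a <- G & m < a.1].

(* [fosd F G]: F weakly first-order stochastically dominates G. *)
Definition fosd (R : realType) (F G : fdistr R) : Prop :=
  forall z, cdf_of F z <= cdf_of G z.

Definition same_distr (R : realType) (F G : fdistr R) : Prop :=
  forall z, cdf_of F z = cdf_of G z.

(* [is_spread G' G]: G' is a spread of G. *)
Definition is_spread (R : realType) (G' G : fdistr R) : Prop :=
  [/\ fosd (left_distr G) (left_distr G'),
      fosd (right_distr G') (right_distr G) &
      ~ same_distr (left_distr G) (left_distr G') \/
      ~ same_distr (right_distr G') (right_distr G)].

Definition projected (R : realType) (K : nat) (e : electorate R K)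
    (mu q : 'rV[R]_K) : fdistr R :=
  [seq (dot (bliss e i - mu) q, share e i)
  | i <- enum 'I_(ntypes e)].

(* [q_spread q e' mu' e mu]: e', with center mu', is a q-spread of e, with
   center mu. *)
Definition q_spread (R : realType) (K : nat) (q : 'rV[R]_K)
    (e' : electorate R K) (mu' : 'rV[R]_K)
    (e : electorate R K) (mu : 'rV[R]_K) : Prop :=
  [/\ centrally_symmetric e mu, centrally_symmetric e' mu' &
      is_spread (projected e' mu' q) (projected e mu q)].

(* Main.v *)
(* In coordinates centred at the centre of symmetry, party p's payoff is a maximum,
   over the orders s in which voters can be counted, of an affine function of the
   clamped advantages: since nu is concave, weighting voters by the increments of
   nu along an order is optimal exactly when the most favourable voters come
   first.  When no advantage is clamped, the weighted mean X_s of the bliss points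
   turns the payoff against own platform w and opposing platform o into
     nu(0) + 1/2 + max_s (|X_s - o|^2 - |X_s - w|^2) / (2 phi).
   Hence in a Nash equilibrium both platforms are such means, each party gets
   nu(0) + 1/2 + |w - o|^2 / (2 phi), and the party-preferred equilibria are the
   antipodal pairs (X, -X) with |X|^2 = M maximal, with payoff
   nu(0) + 1/2 + 4 M / (2 phi).

   The two payoffs of an antipodal profile (w, -w) add up to the expectation of
   g(S), where g(s) = nu(s) + nu(1 - s) increases strictly up to 1/2 and S is the
   mass of the projected distribution beyond a level.  A spread increases this mass
   on both sides of the median, hence increases the sum of the payoffs strictly.
   For the equilibrium w of the first electorate the sum is twice
   nu(0) + 1/2 + 4 M / (2 phi), while in the second one it is at most twice
   nu(0) + 1/2 + 2 (M + M') / (2 phi), because 4 X.w <= 2 (|X|^2 + |w|^2);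
   so M < M'. *)
Require Import Defs.
From mathcomp Require Import all_boot all_order all_algebra.
From mathcomp Require Import all_classical all_reals all_analysis.
From mathcomp Require Import perm ring lra.
Import Order.TTheory GRing.Theory Num.Theory.
Import numFieldNormedType.Exports.

Local Open Scope classical_set_scope.
Local Open Scope ring_scope.

(** * Weights along an order of the voters *)

(** The points [b] and [a + d] are the convex combinations of [a] and [b + d] with weights [t] and
    [1 - t] exchanged; adding the two strict concavity inequalities gives the claim. *)
Lemma strictly_concave_increment {R : realType} {f : R -> R} :
  strictly_concave_on 0 1 f -> forall a b d : R,
  0 <= a -> a < b -> 0 < d -> b + d <= 1 -> f (b + d) - f b < f (a + d) - f a.
Proof.
move=> fc a b d a0 ab d0 bd1.
have L0 : 0 < b + d - a by lra.
pose t := d / (b + d - a).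
have t01 : 0 < t < 1.
  by rewrite /t divr_gt0//= ltr_pdivrMr// mul1r; lra.
have t01' : 0 < 1 - t < 1 by lra.
have abd : a != b + d by apply/eqP; lra.
have aI : a \in `[0, 1] by rewrite in_itv/=; lra.
have bI : b + d \in `[0, 1] by rewrite in_itv/=; lra.
have tE : t * (b + d - a) = d by rewrite /t divfK// gt_eqF.
have := fc a (b + d) t aI bI abd t01.
have := fc a (b + d) (1 - t) aI bI abd t01'.
have -> : (1 - t) * a + (1 - (1 - t)) * (b + d) = a + d by rewrite -{2}tE; ring.
have -> : t * a + (1 - t) * (b + d) = b.
  by rewrite -[RHS](addrK d) -{3}tE; ring.
lra.
Qed.

Section marginals.
Context {R : realType} {n : nat} {nu : R -> R} {s : 'I_n -> R}.
Hypothesis nu_conc : strictly_concave_on 0 1 nu.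
Hypothesis s_gt0 : forall i, 0 < s i.
Hypothesis s_sum1 : \sum_i s i = 1.

Lemma coalition_ge0 (T : pred 'I_n) : 0 <= \sum_(i | T i) s i.
Proof. by apply: sumr_ge0 => i _; exact: ltW. Qed.

Lemma coalition_compl (T : pred 'I_n) :
  \sum_(i | ~~ T i) s i = 1 - \sum_(i | T i) s i.
Proof. by move: s_sum1; rewrite (bigID T)/= => <-; rewrite addrAC subrr add0r. Qed.

Lemma coalition_le1 (T : pred 'I_n) : \sum_(i | T i) s i <= 1.
Proof. by rewrite -subr_ge0 -coalition_compl coalition_ge0. Qed.

Lemma coalition_le {T T' : pred 'I_n} : {subset T <= T'} ->
  \sum_(i | T i) s i <= \sum_(i | T' i) s i.
Proof.
move=> TT'; rewrite [leRHS](bigID T)/= [X in _ <= X + _](eq_bigl T).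
  by rewrite lerDl coalition_ge0.
by move=> i; case: (boolP (T i)) => Ti; rewrite ?andbT ?andbF//; exact: TT'.
Qed.

(** [p i] is the rank at which voter [i] is counted. These are the marginal contributions of the set
    function sending a coalition to [nu] of its total share, which is submodular when [nu] is
    concave. *)
Definition marginal (p : {perm 'I_n}) (i : 'I_n) : R :=
  nu (\sum_(j | (p j <= p i)%N) s j) - nu (\sum_(j | (p j < p i)%N) s j).

Lemma sum_before_step (p : {perm 'I_n}) (F : 'I_n -> R) (T : pred 'I_n) (i : 'I_n) :
  \sum_(j | T j && (p j < (p i).+1)%N) F j =
  (if T i then F i else 0) + \sum_(j | T j && (p j < p i)%N) F j.
Proof.
have pE j : (p j < (p i).+1)%N = (j == i) || (p j < p i)%N.
  rewrite ltnS leq_eqVlt; congr (_ || _).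
  by apply/eqP/eqP => [/ord_inj/perm_inj//|->].
case: (boolP (T i)) => Ti.
  rewrite (bigD1 i)/=; last by rewrite Ti ltnS leqnn.
  congr (_ + _); apply: eq_bigl => j; rewrite pE.
  by case: eqVneq => [->|]; rewrite ?ltnn ?andbF ?andbT.
rewrite add0r; apply: eq_bigl => j; rewrite pE.
by case: eqVneq => [->|//]; rewrite (negbTE Ti).
Qed.

Lemma sum_before_all (p : {perm 'I_n}) (F : 'I_n -> R) (T : pred 'I_n) :
  \sum_(j | T j && (p j < n)%N) F j = \sum_(j | T j) F j.
Proof. by apply: eq_bigl => j; rewrite ltn_ord andbT. Qed.

Lemma marginalE p i : marginal p i =
  nu (s i + \sum_(j | (p j < p i)%N) s j) - nu (\sum_(j | (p j < p i)%N) s j).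
Proof.
rewrite /marginal; have /= := sum_before_step p s predT i.
by under eq_bigl do rewrite ltnS; move=> ->.
Qed.

Lemma marginal_gt0 (nu_incr : strictly_increasing_on 0 1 nu) p i :
  0 < marginal p i.
Proof.
have := sum_before_step p s predT i; rewrite /=.
under eq_bigl do rewrite ltnS.
move=> E; rewrite subr_gt0; apply: nu_incr.
- by rewrite in_itv/= coalition_ge0 coalition_le1.
- by rewrite in_itv/= coalition_ge0 coalition_le1.
- by rewrite E ltrDr.
Qed.

(** Induction on a cutoff for the ranks. The voter of rank [k], if in [T], joins the earlier members
    of [T] only, a coalition no larger than all earlier voters, so by concavity its actual increment
    is at least its marginal. *)
Lemma sum_marginal_le p (T : pred 'I_n) :
  nu 0 + \sum_(i | T i) marginal p i <= nu (\sum_(i | T i) s i).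
Proof.
suff: forall k, (k <= n)%N ->
    nu 0 + \sum_(i | T i && (p i < k)%N) marginal p i
    <= nu (\sum_(i | T i && (p i < k)%N) s i).
  by move=> /(_ n (leqnn n)); rewrite !sum_before_all.
elim=> [|k IH] kn.
  by rewrite !big_pred0 ?addr0// => i; rewrite ltn0 andbF.
have /= := IH (ltnW kn).
pose i := (p^-1)%g (Ordinal kn).
have <- : p i = k :> nat by rewrite permKV.
rewrite !sum_before_step; case: ifP => [_|_]; last by rewrite !add0r.
set a := (X in _ <= nu X) => H.
rewrite addrCA; apply: (@le_trans _ _ (marginal p i + nu a)); first by rewrite lerD2l.
rewrite -lerBrDr marginalE ![s i + _]addrC -/a.
have : a <= \sum_(j | (p j < p i)%N) s j.
  by apply: coalition_le => j /andP[].
rewrite le_eqVlt => /predU1P[->//|ab].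
apply: ltW; apply: (strictly_concave_increment nu_conc) => //.
  exact: coalition_ge0.
have := sum_before_step p s predT i; rewrite /= addrC => <-.
exact: coalition_le1.
Qed.

(** When [T] is an initial segment of the order, the earlier members of [T] are all the earlier
    voters, and the marginals telescope. *)
Lemma sum_marginal_eq (p : {perm 'I_n}) (T : pred 'I_n) :
  (forall i j, T i -> (p j <= p i)%N -> T j) ->
  nu 0 + \sum_(i | T i) marginal p i = nu (\sum_(i | T i) s i).
Proof.
move=> Tp.
suff: forall k, (k <= n)%N ->
    nu 0 + \sum_(i | T i && (p i < k)%N) marginal p i
    = nu (\sum_(i | T i && (p i < k)%N) s i).
  by move=> /(_ n (leqnn n)); rewrite !sum_before_all.
elim=> [|k IH] kn.
  by rewrite !big_pred0 ?addr0// => i; rewrite ltn0 andbF.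
have /= := IH (ltnW kn).
pose i := (p^-1)%g (Ordinal kn).
have <- : p i = k :> nat by rewrite permKV.
rewrite !sum_before_step; case: ifP => [Ti|_]; last by rewrite !add0r.
move=> H; rewrite addrCA H marginalE.
have -> : \sum_(j | T j && (p j < p i)%N) s j = \sum_(j | (p j < p i)%N) s j.
  apply: eq_bigl => j; case: ltnP => pji; rewrite ?andbF// andbT.
  by apply: Tp Ti _; exact: ltnW.
by rewrite subrK.
Qed.

Lemma sum_marginal (nu_norm : nu 1 - nu 0 = 1) p : \sum_i marginal p i = 1.
Proof. by have := @sum_marginal_eq p predT (fun _ _ _ _ => isT); rewrite s_sum1; lra. Qed.

Lemma sorting_perm (f : 'I_n -> R) :
  exists p : {perm 'I_n}, forall i j, (p i <= p j)%N -> f j <= f i.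
Proof.
pose r := relpre f >=%R.
have r_total : total r by move=> i j; exact: ge_total.
have r_trans : transitive r by move=> i j k /= ij ki; exact: le_trans ki ij.
pose l := sort r (enum 'I_n).
have lmem i : i \in l by rewrite mem_sort mem_enum.
have idx_lt i : (index i l < n)%N.
  by have := lmem i; rewrite -index_mem size_sort size_enum_ord.
have inj : injective (fun i => Ordinal (idx_lt i)).
  by move=> i j /(congr1 val) /= ij; rewrite -(nth_index i (lmem i)) ij nth_index.
exists (perm inj) => i j; rewrite !permE/= => ij.
have := sorted_leq_nth r_trans (fun x => lexx (f x)) i (sort_sorted r_total (enum 'I_n)).
move=> /(_ (index i l) (index j l)); rewrite !inE !index_mem !lmem.
by move=> /(_ isT isT ij); rewrite !nth_index.
Qed.

End marginals.

Arguments marginal {R n} nu s p i.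

(** * Expectations of step functions and the uniform shock *)

Section step_functions.
Context {d : measure_display} {T : measurableType d} {R : realType}.
Context (P : probability T R) {n : nat} (c : R) (w : 'I_n -> R) (E : 'I_n -> set T).
Hypothesis mE : forall i, measurable (E i).

Let step_EFin : EFin \o (fun t => c + \sum_i w i * \1_(E i) t) =
    (EFin \o cst c) \+ (fun t => \sum_i ((w i)%:E * (\1_(E i) t)%:E))%E.
Proof. by apply/funext => t /=; rewrite EFinD -sumEFin. Qed.

Let integrable_term i : P.-integrable setT (fun t => (w i)%:E * (\1_(E i) t)%:E)%E.
Proof. by apply: integrableZl => //; exact: integrable_indic. Qed.

Lemma integrable_step :
  P.-integrable setT (EFin \o (fun t => c + \sum_i w i * \1_(E i) t)).
Proof.
rewrite step_EFin; apply: integrableD => //.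
  exact: finite_measure_integrable_cst.
by apply: integrable_sum => // i _; exact: integrable_term.
Qed.

Lemma expectation_step :
  ('E_P[fun t => (c + \sum_i w i * \1_(E i) t)%R] =
    (c + \sum_i w i * fine (P (E i)))%:E)%E.
Proof.
rewrite unlock -/(comp EFin _) step_EFin integralD//=; last 2 first.
- exact: finite_measure_integrable_cst.
- by apply: integrable_sum => // i _; exact: integrable_term.
have := expectation_cst P c; rewrite unlock => ->; rewrite integral_sum//.
rewrite EFinD -sumEFin; congr (_ + _)%E; apply: eq_bigr => i _.
rewrite integralZl//; last exact: integrable_indic.
by rewrite integral_indic// setIT EFinM fineK// fin_num_measure.
Qed.

End step_functions.

Section expectation.
Context {d : measure_display} {T : measurableType d} {R : realType}.
Context (P : probability T R) (f g : T -> R).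
Hypothesis f_int : P.-integrable setT (EFin \o f).
Hypothesis g_int : P.-integrable setT (EFin \o g).

Lemma expectation_mono : (forall t, f t <= g t) -> ('E_P[f] <= 'E_P[g])%E.
Proof. by move=> fg; rewrite unlock le_integral// => t _; rewrite lee_fin. Qed.

Lemma expectation_add : ('E_P[fun t => (f t + g t)%R] = 'E_P[f] + 'E_P[g])%E.
Proof. by rewrite unlock -integralD_EFin. Qed.

Lemma integrable_add : P.-integrable setT (EFin \o (fun t => f t + g t)).
Proof. exact: (integrableD measurableT f_int g_int). Qed.

End expectation.

(** Serves twice: [(clamp phi z + phi) / (2 * phi)] is the cdf of the shock, and clamping each
    coordinate projects onto a rectangle. *)
Definition clamp {R : realType} (phi z : R) : R := Num.max (- phi) (Num.min z phi).

Section clamp.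
Context {R : realType} {phi : R} (phi_ge0 : 0 <= phi).

Lemma clampP z : [\/ z <= - phi /\ clamp phi z = - phi,
  - phi <= z <= phi /\ clamp phi z = z | phi <= z /\ clamp phi z = phi].
Proof.
move: phi_ge0 => ?; rewrite /clamp; have [zphi|phiz] := leP z phi.
  by have [H|H] := leP (- phi) z; [apply: Or32|apply: Or31; rewrite ltW].
have pp : - phi <= phi by lra.
by apply: Or33; rewrite max_r// ltW.
Qed.

Lemma clamp_id z : `|z| <= phi -> clamp phi z = z.
Proof. by rewrite ler_norml; case: (clampP z) => -[]; lra. Qed.

Lemma clampN z : clamp phi (- z) = - clamp phi z.
Proof.
move: phi_ge0 => ?.
by case: (clampP z) => -[? ->]; case: (clampP (- z)) => -[? ->]; lra.
Qed.

Lemma clamp_le z z' : z <= z' -> clamp phi z <= clamp phi z'.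
Proof.
move: phi_ge0 => ? ?.
by case: (clampP z) => -[? ->]; case: (clampP z') => -[? ->]; lra.
Qed.

Lemma clamp_lt z z' : z < z' -> - phi < z' -> z < phi ->
  0 < phi -> clamp phi z < clamp phi z'.
Proof.
move=> ? ? ? ?.
by case: (clampP z) => -[? ->]; case: (clampP z') => -[? ->]; lra.
Qed.

Lemma normr_clamp z : `|clamp phi z| <= phi.
Proof.
by move: phi_ge0 => ?; rewrite ler_norml; case: (clampP z) => -[? ->]; lra.
Qed.

Lemma clamp_closer z y : `|y| <= phi -> (clamp phi z - y) ^+ 2 <= (z - y) ^+ 2.
Proof.
move: phi_ge0 => ?; rewrite ler_norml => /andP[? ?].
by case: (clampP z) => -[? ->]; nra.
Qed.

Lemma clamp_closer_lt z y : `|y| <= phi -> phi < `|z| ->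
  (clamp phi z - y) ^+ 2 < (z - y) ^+ 2.
Proof.
move: phi_ge0 => ?; rewrite ler_norml ltr_normr => /andP[? ?] /orP[] ?.
  by case: (clampP z) => -[? ->]; nra.
by case: (clampP z) => -[? ->]; nra.
Qed.

End clamp.

Section shock.
Context {R : realType} {phi : R} (phi_gt0 : 0 < phi).

Lemma shock_le (z : R) :
  shock phi_gt0 [set eps | eps <= z] = ((clamp phi z + phi) / (2 * phi))%:E.
Proof.
transitivity (\int[lebesgue_measure]_(x in [set` `[- phi, Num.min z phi]%R])
    ((phi - - phi)^-1)%R%:E)%E.
  rewrite /shock/= /uniform_prob integral_uniform_pdf.
  have -> : [set eps | eps <= z] `&` [set` `[- phi, phi]] =
      [set` `[- phi, Num.min z phi]].
    by apply/seteqP; split=> t /=; rewrite !in_itv/= le_min; lra.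
  apply: eq_integral => t; rewrite inE/= in_itv/= le_min /uniform_pdf.
  by move=> /andP[-> /andP[_ ->]].
rewrite integral_cst//= lebesgue_measure_itv/= lte_fin.
(* In the negative case the interval is empty or a point, and [clamp phi z] is [- phi]. *)
case: ifPn => H; last first.
  rewrite mule0 /clamp max_l; last by rewrite leNgt.
  by rewrite addNr mul0r.
rewrite -EFinD -EFinM; congr EFin.
rewrite /clamp max_r; last exact: ltW.
by rewrite opprK mulrC -mulr2n mulr_natl.
Qed.

Lemma measurable_le (z : R) : measurable [set eps : measurableTypeR R | eps <= z].
Proof.
have -> : [set eps : measurableTypeR R | eps <= z] = [set` `]-oo, z]].
  by apply/seteqP; split=> t /=; rewrite in_itv.
exact: measurable_itv.
Qed.

(** Stated with [clamp phi (- z)] so that the probability of a vote for B has the same form in B's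
    gain as that of a vote for A in A's gain. *)
Lemma shock_gt (z : R) :
  shock phi_gt0 [set eps | z < eps] = ((clamp phi (- z) + phi) / (2 * phi))%:E.
Proof.
have -> : [set eps | z < eps] = ~` [set eps | eps <= z].
  by apply/seteqP; split=> t /=; rewrite ltNge => /negP.
rewrite probability_setC; last exact: measurable_le.
rewrite [X in (_ - X)%E]shock_le -EFinB (clampN (ltW phi_gt0)); congr EFin; field.
by rewrite gt_eqF.
Qed.

End shock.

(** * Payoffs as maxima over orders *)

Section payoffs.
Context {R : realType} {K : nat} {nu : R -> R} {phi : R} (phi_gt0 : 0 < phi).
Hypothesis nu_conc : strictly_concave_on 0 1 nu.
Hypothesis nu_norm : nu 1 - nu 0 = 1.
Context (e : electorate R K).

Definition own (p : party) (x : profile R K) : 'rV[R]_K :=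
  match p with PartyA => x.1 | PartyB => x.2 end.

Definition opponent (p : party) (x : profile R K) : 'rV[R]_K :=
  match p with PartyA => x.2 | PartyB => x.1 end.

Definition gain (p : party) (x : profile R K) (i : 'I_(ntypes e)) : R :=
  sqnorm (opponent p x - bliss e i) - sqnorm (own p x - bliss e i).

(** Ties count for A, hence the strict inequality for B; the vote shares then agree at every shock,
    not only almost surely. *)
Definition supports (p : party) (x : profile R K) (i : 'I_(ntypes e)) (eps : R) : bool :=
  match p with
  | PartyA => eps <= advantage x i
  | PartyB => advantage x i < eps
  end.

Lemma vote_shareE p x eps :
  vote_share e x p eps = \sum_(i | supports p x i eps) share e i.
Proof.
case: p => //=; rewrite -coalition_compl ?share_sum1//.
by apply: eq_bigl => i; rewrite ltNge.
Qed.

Lemma shock_supports p x i :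
  shock phi_gt0 [set eps | supports p x i eps] =
  ((clamp phi (gain p x i) + phi) / (2 * phi))%:E.
Proof.
case: p => /=; first exact: shock_le.
by rewrite shock_gt /gain/= /advantage opprB.
Qed.

Lemma measurable_supports p x i :
  measurable [set eps : measurableTypeR R | supports p x i eps].
Proof.
case: p => /=; first exact: measurable_le.
have -> : [set eps : measurableTypeR R | advantage x i < eps] =
    ~` [set eps | eps <= advantage x i].
  by apply/seteqP; split=> t /=; rewrite ltNge => /negP.
by apply: measurableC; exact: measurable_le.
Qed.

Definition marginal_votes (s : {perm 'I_(ntypes e)}) p x (eps : R) : R :=
  nu 0 + \sum_i marginal nu (share e) s i *
    \1_[set eps : measurableTypeR R | supports p x i eps] eps.

Lemma marginal_votesE s p x eps : marginal_votes s p x eps =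
  nu 0 + \sum_(i | supports p x i eps) marginal nu (share e) s i.
Proof.
rewrite /marginal_votes; apply: congr1.
rewrite [RHS]big_mkcond/=.
apply: eq_bigr => i _.
rewrite indicE mem_setE (_ : (eps \in supports p x i) = supports p x i eps)//.
by case: supports; rewrite /= ?mulr1 ?mulr0.
Qed.

Lemma marginal_votes_le s p x eps :
  marginal_votes s p x eps <= nu (vote_share e x p eps).
Proof.
rewrite marginal_votesE vote_shareE.
exact: (sum_marginal_le nu_conc (@share_gt0 _ _ e) (share_sum1 e) s
  (fun i => supports p x i eps)).
Qed.

(** One order serves all shocks: ranked by decreasing gain, the supporters of [p] form an initial
    segment whatever [eps] is. *)
Lemma marginal_votes_sorted p x : exists s, forall eps,
  nu (vote_share e x p eps) = marginal_votes s p x eps.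
Proof.
have [s sP] := sorting_perm (gain p x); exists s => eps.
rewrite marginal_votesE vote_shareE.
rewrite (sum_marginal_eq s (fun i => supports p x i eps))// => i j + /sP.
case: p {sP} => /=; rewrite /gain/=.
  by move=> H1 H2; exact: le_trans H1 H2.
move=> H1 H2; apply: le_lt_trans H1.
by rewrite -lerN2 !opprB.
Qed.

Lemma integrable_marginal_votes s p x :
  (shock phi_gt0).-integrable setT (EFin \o marginal_votes s p x).
Proof. by apply: integrable_step => i; exact: measurable_supports. Qed.

Lemma integrable_votes p x :
  (shock phi_gt0).-integrable setT (EFin \o (fun eps => nu (vote_share e x p eps))).
Proof.
have [s /funext ->] := marginal_votes_sorted p x.
exact: integrable_marginal_votes.
Qed.

(** The expectation of [marginal_votes]; the term [2^-1] is the [phi / (2 * phi)] in each voting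
    probability, summed against weights of total 1. *)
Definition value (s : {perm 'I_(ntypes e)}) (p : party) (x : profile R K) : R :=
  nu 0 + 2^-1 +
  (\sum_i marginal nu (share e) s i * clamp phi (gain p x i)) / (2 * phi).

Lemma expectation_marginal_votes s p x :
  ('E_(shock phi_gt0)[marginal_votes s p x] = (value s p x)%:E)%E.
Proof.
rewrite expectation_step; last by move=> i; exact: measurable_supports.
congr EFin; rewrite /value -addrA; congr (_ + _).
under eq_bigr do rewrite shock_supports/= mulrA mulrDr.
rewrite -mulr_suml big_split/= -mulr_suml (sum_marginal (share_sum1 e))//.
by field; rewrite gt_eqF.
Qed.

Lemma value_le_payoff s p x : ((value s p x)%:E <= payoff phi_gt0 nu e p x)%E.
Proof.
rewrite -expectation_marginal_votes; apply: expectation_mono.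
- exact: integrable_marginal_votes.
- exact: integrable_votes.
- exact: marginal_votes_le.
Qed.

Lemma payoff_value p x :
  exists s, payoff phi_gt0 nu e p x = (value s p x)%:E.
Proof.
have [s sP] := marginal_votes_sorted p x; exists s.
by rewrite -expectation_marginal_votes; congr expectation; apply/funext.
Qed.

Hypothesis nu_incr : strictly_increasing_on 0 1 nu.

(** The order that is exact at [x] still bounds the payoff at [x'] from below, and its weights are
    positive. *)
Lemma le_payoff p x x' : (forall i, gain p x i <= gain p x' i) ->
  (payoff phi_gt0 nu e p x <= payoff phi_gt0 nu e p x')%E.
Proof.
move=> le_gain; have [s ->] := payoff_value p x.
apply: le_trans (value_le_payoff s p x'); rewrite lee_fin lerD2l.
rewrite ler_pM2r ?invr_gt0 ?mulr_gt0//; apply: ler_sum => i _.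
rewrite ler_wpM2l ?(clamp_le (ltW phi_gt0))//.
exact/ltW/(marginal_gt0 (@share_gt0 _ _ e) (share_sum1 e) nu_incr).
Qed.

Lemma lt_payoff p x x' i0 :
  (forall i, gain p x i <= gain p x' i) ->
  clamp phi (gain p x i0) < clamp phi (gain p x' i0) ->
  (payoff phi_gt0 nu e p x < payoff phi_gt0 nu e p x')%E.
Proof.
have m0 s i : 0 < marginal nu (share e) s i.
  exact: (marginal_gt0 (@share_gt0 _ _ e) (share_sum1 e) nu_incr).
move=> le_gain lt_gain; have [s ->] := payoff_value p x.
apply: lt_le_trans (value_le_payoff s p x'); rewrite lte_fin ltrD2l.
rewrite ltr_pM2r ?invr_gt0 ?mulr_gt0// (bigD1 i0)//= [ltRHS](bigD1 i0)//=.
apply: ltr_leD; first by rewrite ltr_pM2l.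
by apply: ler_sum => i _; rewrite ler_wpM2l ?(clamp_le (ltW phi_gt0))// ltW.
Qed.

End payoffs.

(** * Equilibria *)

Section dot.
Context {R : realType} {K : nat}.
Implicit Types u v w : 'rV[R]_K.

Lemma dotC u v : dot u v = dot v u.
Proof. by apply: eq_bigr => k _; rewrite mulrC. Qed.

Lemma dotDl u v w : dot (u + v) w = dot u w + dot v w.
Proof. by rewrite -big_split/=; apply: eq_bigr => k _; rewrite mxE mulrDl. Qed.

Lemma dotZl c u v : dot (c *: u) v = c * dot u v.
Proof. by rewrite mulr_sumr; apply: eq_bigr => k _; rewrite mxE mulrA. Qed.

Lemma dotNl u v : dot (- u) v = - dot u v.
Proof. by rewrite -scaleN1r dotZl mulN1r. Qed.

Lemma dotDr u v w : dot u (v + w) = dot u v + dot u w.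
Proof. by rewrite dotC dotDl !(dotC u). Qed.

Lemma dotNr u v : dot u (- v) = - dot u v.
Proof. by rewrite dotC dotNl dotC. Qed.

Lemma dotZr c u v : dot u (c *: v) = c * dot u v.
Proof. by rewrite dotC dotZl dotC. Qed.

Lemma dot_sumr u n (f : 'I_n -> 'rV[R]_K) : dot u (\sum_i f i) = \sum_i dot u (f i).
Proof.
rewrite /dot exchange_big/=; apply: eq_bigr => k _.
by rewrite -mulr_sumr summxE.
Qed.

Lemma sqnormE u : sqnorm u = \sum_k u ord0 k ^+ 2.
Proof. by apply: eq_bigr => k _; rewrite expr2. Qed.

Lemma sqnorm_ge0 u : 0 <= sqnorm u.
Proof. by rewrite sqnormE; apply: sumr_ge0 => k _; exact: sqr_ge0. Qed.

Lemma sqnorm_eq0 u : sqnorm u = 0 -> u = 0.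
Proof.
rewrite sqnormE => /eqP; rewrite psumr_eq0; last by move=> k _; exact: sqr_ge0.
move=> /allP u0; apply/rowP => k; rewrite mxE; apply/eqP.
by have := u0 k (mem_index_enum k); rewrite /= sqrf_eq0.
Qed.

Lemma sqnormB u v : sqnorm (u - v) = sqnorm u - 2 * dot u v + sqnorm v.
Proof.
rewrite /sqnorm !(dotDl, dotDr, dotNl, dotNr) (dotC v u); ring.
Qed.

Lemma sqnormN u : sqnorm (- u) = sqnorm u.
Proof. by rewrite /sqnorm dotNl dotNr opprK. Qed.

Lemma sqnormD u v : sqnorm (u + v) = sqnorm u + 2 * dot u v + sqnorm v.
Proof. by rewrite -[v in LHS]opprK sqnormB dotNr sqnormN; ring. Qed.

End dot.

(** * Best responses and equilibrium payoffs *)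

Definition redirect {R : realType} {K : nat} (p : party) (x : profile R K)
    (z : 'rV[R]_K) : profile R K :=
  match p with PartyA => (z, x.2) | PartyB => (x.1, z) end.

Definition rival (p : party) : party :=
  match p with PartyA => PartyB | PartyB => PartyA end.

Lemma nashP {R : realType} {K : nat} {phi : R} {phi_gt0 : 0 < phi} {nu : R -> R}
    {e : electorate R K} {x : profile R K} :
  nash phi_gt0 nu e x <-> forall p z,
    (payoff phi_gt0 nu e p (redirect p x z) <= payoff phi_gt0 nu e p x)%E.
Proof.
split=> [[nA nB] [] z|H]; [exact: nA|exact: nB|].
by split=> z; [exact: (H PartyA)|exact: (H PartyB)].
Qed.

Section equilibria.
Context {R : realType} {K : nat} {nu : R -> R} {phi : R} (phi_gt0 : 0 < phi).
Hypothesis nu_conc : strictly_concave_on 0 1 nu.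
Hypothesis nu_norm : nu 1 - nu 0 = 1.
Hypothesis nu_incr : strictly_increasing_on 0 1 nu.
Context (e : electorate R K) (mu : 'rV[R]_K).
Hypothesis e_sym : centrally_symmetric e mu.

Let y i := bliss e i - mu.
Let m := marginal nu (share e).
Let N_gt0 : (0 < ntypes e)%N := ltnW (ntypes_ge2 e).
Let i0 : 'I_(ntypes e) := Ordinal N_gt0.
Let pay := payoff phi_gt0 nu e.

Let shiftK (z : 'rV[R]_K) : mu + z - mu = z.
Proof. by rewrite addrC addKr. Qed.

Definition position p (x : profile R K) : 'rV[R]_K := own p x - mu.

Lemma opponentE p (x : profile R K) : opponent p x - mu = position (rival p) x.
Proof. by case: p. Qed.

Lemma gainE p x i :
  gain e p x i = sqnorm (position (rival p) x - y i) - sqnorm (position p x - y i).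
Proof.
have shift z : z - bliss e i = z - mu - y i by rewrite /y opprB addrA subrK.
by rewrite /gain !shift opponentE.
Qed.

Lemma gain_rival p x i : gain e (rival p) x i = - gain e p x i.
Proof. by case: p; rewrite /gain/= [RHS]opprB. Qed.

Lemma position_redirect p x z : position p (redirect p x z) = z - mu.
Proof. by case: p. Qed.

Lemma position_rival_redirect p x z :
  position (rival p) (redirect p x z) = position (rival p) x.
Proof. by case: p. Qed.

(** Half-widths of the smallest rectangle centred at 0 that holds all centred bliss points. This box
    is closed, so [squash] is its nearest-point projection, whereas [D] may fail to be closed. *)
Definition radius k : R := \big[Num.max/0]_i `|y i ord0 k|.

Lemma le_radius i k : `|y i ord0 k| <= radius k.
Proof. by apply: le_bigmax_cond. Qed.

Lemma radius_ge0 k : 0 <= radius k.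
Proof. exact: le_trans (le_radius i0 k). Qed.

Lemma radius_attained k : exists i, radius k = `|y i ord0 k|.
Proof.
have [//|i _|i _ E] := @Order.TotalTheory.eq_bigmax _ _ _ (0 : R) i0 predT
  (fun i => `|y i ord0 k|); first exact: normr_ge0.
by exists i; exact: E.
Qed.

Definition boxed (z : 'rV[R]_K) := forall k, `|z ord0 k| <= radius k.

Lemma boxedN z : boxed z -> boxed (- z).
Proof. by move=> bz k; rewrite mxE normrN. Qed.

Definition squash (z : 'rV[R]_K) : 'rV[R]_K := \row_k clamp (radius k) (z ord0 k).

Lemma boxed_squash z : boxed (squash z).
Proof. by move=> k; rewrite mxE; apply/normr_clamp/radius_ge0. Qed.

Lemma squash_closer z i : sqnorm (squash z - y i) <= sqnorm (z - y i).
Proof.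
rewrite !sqnormE; apply: ler_sum => k _; rewrite !mxE.
by apply: clamp_closer (radius_ge0 k) _ _ _; have := le_radius i k; rewrite !mxE.
Qed.

Lemma squash_closer_lt z i : ~ boxed z -> sqnorm (squash z - y i) < sqnorm (z - y i).
Proof.
move=> /existsNP[k /negP]; rewrite -ltNge => zk.
rewrite !sqnormE (bigD1 k)//= [ltRHS](bigD1 k)//= !mxE.
apply: ltr_leD.
  by apply: clamp_closer_lt (radius_ge0 k) _ _ _ zk; have := le_radius i k; rewrite !mxE.
apply: ler_sum => l _; rewrite !mxE.
by apply: clamp_closer (radius_ge0 l) _ _ _; have := le_radius i l; rewrite !mxE.
Qed.

Context (D : set 'rV[R]_K).
Hypothesis boxD : forall z, boxed z -> D z.
Hypothesis narrow : forall a b, D a -> D b ->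
  forall i, `|sqnorm (b - y i) - sqnorm (a - y i)| < phi.

(* A platform outside the box is farther from every voter than its projection
   onto the box, so a best response can be outside only if the party already
   wins every voter for sure. *)
Lemma nash_outside p x i : nash phi_gt0 nu e x -> ~ boxed (position p x) ->
  phi <= gain e p x i.
Proof.
move=> /nashP/(_ p (mu + squash (position p x))) + out.
apply: contraPle => lt_phi; apply/negP; rewrite -ltNge.
set x' := redirect _ _ _.
have pos' : position p x' = squash (position p x).
  by rewrite position_redirect shiftK.
have posr : position (rival p) x' = position (rival p) x.
  exact: position_rival_redirect.
apply: (@lt_payoff _ _ _ _ phi_gt0 nu_conc nu_norm e nu_incr p x x' i) => [j|].
  by rewrite !gainE pos' posr lerD2l lerN2 squash_closer.
have lt_gain : gain e p x i < gain e p x' i.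
  by rewrite !gainE pos' posr ltrD2l ltrN2 squash_closer_lt.
apply: (clamp_lt (ltW phi_gt0)) => //.
rewrite gainE pos' posr.
have := narrow (squash (position p x)) (squash (position (rival p) x))
  (boxD _ (boxed_squash _)) (boxD _ (boxed_squash _)) i.
rewrite ltr_norml => /andP[+ _] => /lt_le_trans; apply.
by rewrite lerD2r squash_closer.
Qed.

(** If only [p] is outside, its gain is at most that of its projection, which is below [phi]. If
    both are outside, both gains are at least [phi], yet they are opposite. *)
Lemma nash_boxed p x : nash phi_gt0 nu e x -> boxed (position p x).
Proof.
move=> nx; apply: contrapT => out.
have le_p := nash_outside p x i0 nx out.
have [inr|outr] := pselect (boxed (position (rival p) x)).
  move: le_p; rewrite gainE leNgt => /negP; apply.
  have := narrow _ _ (boxD _ (boxed_squash (position p x))) (boxD _ inr) i0.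
  rewrite ltr_norml => /andP[_]; apply: le_lt_trans.
  by rewrite lerD2l lerN2 squash_closer.
have := nash_outside (rival p) x i0 nx outr; rewrite gain_rival.
by move: phi_gt0 le_p; lra.
Qed.

(** The weighted mean X_s of the centred bliss points. *)
Definition vertex (s : {perm 'I_(ntypes e)}) : 'rV[R]_K := \sum_i m s i *: y i.

Lemma m_ge0 s i : 0 <= m s i.
Proof. exact/ltW/(marginal_gt0 (@share_gt0 _ _ e) (share_sum1 e) nu_incr). Qed.

Lemma m_sum1 s : \sum_i m s i = 1.
Proof. exact: (sum_marginal (share_sum1 e) nu_norm). Qed.

Lemma boxed_vertex s : boxed (vertex s).
Proof.
move=> k; rewrite summxE; apply: le_trans (ler_norm_sum _ _ _) _.
rewrite -[leRHS]mul1r -(m_sum1 s) mulr_suml; apply: ler_sum => i _.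
by rewrite mxE normrM (ger0_norm (m_ge0 s i)) ler_wpM2l ?m_ge0 ?le_radius.
Qed.

Lemma sum_m_dist s o : \sum_i m s i * sqnorm (o - y i) =
  sqnorm o - 2 * dot o (vertex s) + \sum_i m s i * sqnorm (y i).
Proof.
under eq_bigr do rewrite sqnormB !mulrDr mulrN mulrCA.
rewrite !big_split/= -mulr_suml m_sum1 mul1r sumrN -mulr_sumr; congr (_ - _ * _ + _).
by rewrite dot_sumr; apply: eq_bigr => i _; rewrite dotZr.
Qed.

Let base : R := nu 0 + 2^-1.

(** With both positions in [D] no gain is clamped. Each weighted sum of squared distances splits
    around the mean [vertex s], and the dispersion terms cancel. *)
Lemma value_vertex s p x : D (position p x) -> D (position (rival p) x) ->
  @value R K nu phi e s p x = base + (sqnorm (vertex s - position (rival p) x)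
    - sqnorm (vertex s - position p x)) / (2 * phi).
Proof.
move=> Dp Dr; rewrite /value; congr (_ + _ / _).
have gainK i : clamp phi (gain e p x i) = gain e p x i.
  by apply: (clamp_id (ltW phi_gt0)); rewrite gainE ltW// narrow.
under eq_bigr do rewrite gainK gainE mulrBr.
rewrite sumrB !sum_m_dist !sqnormB (dotC (vertex s) (position p x)).
by rewrite (dotC (vertex s) (position (rival p) x)); ring.
Qed.

(** Compose the order with the reflection of the voters: each voter then gets the weight that its
    mirror image had, because mirror images have equal shares. *)
Lemma vertex_sym s : exists s', vertex s' = - vertex s.
Proof.
have [f fP] := choice e_sym.
have f_inj : injective f.
  move=> i j fij; apply: (@bliss_inj _ _ e).
  by have := (fP i).1; rewrite fij (fP j).1 => /addrI/oppr_inj.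
exists (perm f_inj * s)%g.
pose h := perm f_inj.
rewrite /vertex [in RHS](reindex_inj (@perm_inj _ h)) -sumrN; apply: eq_bigr => i _.
have -> : y (h i) = - y i.
  by rewrite /y permE (fP i).1 opprB scaler_nat mulr2n [_ - bliss e i]addrAC addrK.
rewrite scalerN opprK; congr (_ *: _).
rewrite /m /marginal.
by congr (nu _ - nu _); rewrite [RHS](reindex_inj (@perm_inj _ h));
  apply: eq_big => [j|j _]; rewrite ?permM// permE (fP j).2.
Qed.

(** Take an order [s] that is exact at [x]. Moving to [vertex s] would add at least the squared
    distance to it, over [2 * phi], so this distance is 0. *)
Lemma nash_vertex p x : nash phi_gt0 nu e x ->
  (exists s, position p x = vertex s) /\
  pay p x = (base + sqnorm (position p x - position (rival p) x) / (2 * phi))%:E.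
Proof.
move=> nx; have inD q : D (position q x) by apply: boxD; exact: nash_boxed.
have [s ps] := payoff_value phi_gt0 nu_norm e p x.
have {}ps : pay p x = _ := ps.
rewrite value_vertex// in ps.
have : position p x = vertex s.
  have := (nashP.1 nx) p (mu + vertex s); rewrite -/pay ps.
  move=> /(le_trans (value_le_payoff phi_gt0 nu_conc nu_norm e s p _)).
  have pos : position p (redirect p x (mu + vertex s)) = vertex s.
    by rewrite position_redirect shiftK.
  rewrite value_vertex ?pos ?position_rival_redirect//; last exact/boxD/boxed_vertex.
  rewrite lee_fin lerD2l ler_pM2r ?invr_gt0 ?mulr_gt0// lerD2l lerN2 subrr.
  have -> : sqnorm (0 : 'rV[R]_K) = 0.
    by rewrite sqnormE big1// => k _; rewrite mxE expr0n.
  move=> H; apply/esym/eqP; rewrite -subr_eq0; apply/eqP/sqnorm_eq0/eqP.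
  by rewrite eq_le H sqnorm_ge0.
move=> E; split; first by exists s.
rewrite ps -E subrr [X in _ - X](_ : _ = 0) ?subr0//.
by rewrite sqnormE big1// => k _; rewrite mxE expr0n.
Qed.


Context (M : R).
Hypothesis vertex_le : forall s, sqnorm (vertex s) <= M.

Definition best_payoff : R := base + 4 * M / (2 * phi).

(** With r the rival's position, the parallelogram law gives |X_s - r|^2 <= 2 |X_s|^2 + 2 |r|^2 <= 4
    M. *)
Lemma payoff_le_best p x : D (position p x) -> D (position (rival p) x) ->
  sqnorm (position (rival p) x) <= M -> (pay p x <= best_payoff%:E)%E.
Proof.
move=> Dp Dr rM; have [s] := payoff_value phi_gt0 nu_norm e p x.
rewrite -/pay => ->; rewrite value_vertex// lee_fin lerD2l.
rewrite ler_pM2r ?invr_gt0 ?mulr_gt0//.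
have := sqnorm_ge0 (vertex s - position p x).
have := sqnorm_ge0 (vertex s + position (rival p) x).
rewrite sqnormD; have := sqnormB (vertex s) (position (rival p) x).
have := vertex_le s; lra.
Qed.

Lemma nash_le_best p x : nash phi_gt0 nu e x -> (pay p x <= best_payoff%:E)%E.
Proof.
move=> nx; have inD q : D (position q x) by apply: boxD; exact: nash_boxed.
apply: payoff_le_best => //.
by have [[s ->] _] := nash_vertex (rival p) x nx.
Qed.

Context (s0 : {perm 'I_(ntypes e)}).
Hypothesis vertex_max : sqnorm (vertex s0) = M.

Let opt : profile R K := (mu + vertex s0, mu - vertex s0).

Let position_opt p : position p opt = - position (rival p) opt /\
  exists s, position p opt = vertex s.
Proof.
case: p; rewrite /position/= !shiftK; split; rewrite ?opprK//.
  by exists s0.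
by have [s <-] := vertex_sym s0; exists s.
Qed.

Let position_opt_sq p : sqnorm (position p opt) = M.
Proof. by case: p; rewrite /position/= shiftK ?sqnormN. Qed.

Lemma payoff_opt p : pay p opt = best_payoff%:E.
Proof.
have inD q : D (position q opt).
  by have [_ [s ->]] := position_opt q; exact/boxD/boxed_vertex.
apply/eqP; rewrite eq_le payoff_le_best ?position_opt_sq//=.
have [pN [s ps]] := position_opt p.
apply: le_trans (value_le_payoff phi_gt0 nu_conc nu_norm e s p opt).
rewrite value_vertex// lee_fin lerD2l ler_pM2r ?invr_gt0 ?mulr_gt0// -ps.
have -> : position (rival p) opt = - position p opt by rewrite pN opprK.
by rewrite opprK sqnormD sqnormB -/(sqnorm _) position_opt_sq; lra.
Qed.

(** Projecting a deviation onto the box does not lower its payoff; once in [D], the deviation is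
    capped by [best_payoff] because the rival's squared norm is [M]. *)
Lemma nash_opt : nash phi_gt0 nu e opt.
Proof.
apply/nashP => p z; rewrite -!/(pay _ _) payoff_opt.
have inD q : D (position q opt).
  by have [_ [s ->]] := position_opt q; exact/boxD/boxed_vertex.
apply: (@le_trans _ _ (pay p (redirect p opt (mu + squash (z - mu))))).
  apply: le_payoff => // i; rewrite !gainE !position_redirect.
  by rewrite !position_rival_redirect shiftK lerD2l lerN2 squash_closer.
apply: payoff_le_best.
- by rewrite position_redirect shiftK; exact/boxD/boxed_squash.
- by rewrite position_rival_redirect.
- by rewrite position_rival_redirect position_opt_sq.
Qed.

Lemma Vhat_best p : Vhat phi_gt0 nu e p = best_payoff%:E.
Proof.
apply/eqP; rewrite eq_le; apply/andP; split.
  apply: ge_ereal_sup => _ [x [nx _] <-]; exact: nash_le_best.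
rewrite -(payoff_opt p); apply: ereal_sup_ubound; exists opt => //.
split; first exact: nash_opt.
by move=> x nx q; rewrite -!/(pay _ _) payoff_opt; exact: nash_le_best.
Qed.

(** The payoff forces squared distance [4 * M] between positions of squared norm at most [M]; by the
    parallelogram law their sum vanishes. *)
Lemma party_preferred_antipodal x : party_preferred phi_gt0 nu e x ->
  [/\ position PartyB x = - position PartyA x, sqnorm (position PartyA x) = M,
      boxed (position PartyA x) & forall p, pay p x = best_payoff%:E].
Proof.
move=> [nx xmax].
have payx p : pay p x = best_payoff%:E.
  by apply/eqP; rewrite eq_le nash_le_best//= -(payoff_opt p) xmax//; exact: nash_opt.
have [[s sA] payA] := nash_vertex PartyA x nx.
have [[s' sB] _] := nash_vertex PartyB x nx.
have : sqnorm (position PartyA x - position PartyB x) = 4 * M.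
  move: payA; rewrite payx => -[/addrI].
  by move=> /(mulIf _) ->//; rewrite invr_neq0// mulf_neq0// gt_eqF.
have aM : sqnorm (position PartyA x) <= M by rewrite sA.
have bM : sqnorm (position PartyB x) <= M by rewrite sB.
have := sqnorm_ge0 (position PartyA x + position PartyB x).
rewrite sqnormB => ab0 ab.
have /sqnorm_eq0/eqP : sqnorm (position PartyA x + position PartyB x) = 0.
  by move: ab0; rewrite sqnormD; lra.
rewrite addrC addr_eq0 => /eqP ba; split=> //.
- by move: ab; rewrite ba dotNr sqnormN -/(sqnorm _); lra.
- exact: nash_boxed.
Qed.

End equilibria.

Arguments vertex {R K} nu e mu s.
Arguments best_payoff {R} nu phi M.

(** * Projected distributions *)

Lemma gap_below {R : realType} {n : nat} (z : 'I_n -> R) (t : R) :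
  exists2 l, l < t & forall i, z i < t -> z i <= l.
Proof.
(* The default 1 keeps the gap positive when no value lies below [t]. *)
exists (t - \big[Num.min/1]_(i | z i < t) (t - z i)).
  by rewrite ltrBlDr ltrDl; apply: lt_bigmin => // i; rewrite subr_gt0.
by move=> i zi; rewrite lerBrDr -lerBrDl; exact: bigmin_le_cond.
Qed.

Lemma gap_above {R : realType} {n : nat} (z : 'I_n -> R) (t : R) :
  exists2 u, t < u & forall i, t < z i -> u <= z i.
Proof.
have [l lt zl] := gap_below (fun i => - z i) (- t).
exists (- l); first by rewrite ltrNr.
by move=> i ti; rewrite lerNl zl// ltrN2.
Qed.

Section projection.
Context {R : realType} {K : nat} (e : electorate R K) (mu q : 'rV[R]_K).
Hypothesis e_sym : centrally_symmetric e mu.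

Definition height i : R := dot (bliss e i - mu) q.

Definition weight (P : pred R) : R := \sum_(i | P (height i)) share e i.

Lemma weightN (P : pred R) : weight P = weight (fun z => P (- z)).
Proof.
have [f fP] := choice e_sym.
have f_inj : injective f.
  move=> i j fij; apply: (@bliss_inj _ _ e).
  by have := (fP i).1; rewrite fij (fP j).1 => /addrI/oppr_inj.
rewrite /weight (reindex_inj f_inj); apply: eq_big => [i|i _]; last by rewrite (fP i).2.
rewrite /height (fP i).1 -dotNl; congr (P (dot _ _)).
by rewrite opprB scaler_nat mulr2n [_ - bliss e i]addrAC addrK.
Qed.

Lemma eq_weight {P Q : pred R} : P =1 Q -> weight P = weight Q.
Proof. by move=> PQ; apply: eq_bigl => i; exact: PQ. Qed.

Lemma weight_ge0 (P : pred R) : 0 <= weight P.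
Proof. by apply: sumr_ge0 => i _; rewrite ltW// share_gt0. Qed.

Lemma weightC (P : pred R) : weight (fun z => ~~ P z) = 1 - weight P.
Proof. by rewrite /weight (coalition_compl (share_sum1 e)). Qed.

Lemma weight_half (P : pred R) : (forall z, P z -> ~~ P (- z)) -> weight P <= 2^-1.
Proof.
move=> Psym.
suff : weight P <= weight (fun z => ~~ P z) by rewrite weightC; lra.
rewrite weightN; apply: (coalition_le (@share_gt0 _ _ e)) => i.
by rewrite !unfold_in => /Psym; rewrite opprK.
Qed.

Lemma mass_projected (P : pred R) : mass (projected e mu q) P = weight P.
Proof. by rewrite /mass /projected big_map big_enum_cond. Qed.

(** The median set is symmetric about 0, and [inf] is by definition minus the [sup] of the opposite
    set. *)
Lemma median_projected : median_of (projected e mu q) = 0.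
Proof.
rewrite /median_of /inf; set E := median_set _.
suff -> : -%R @` E = E by rewrite addNr mul0r.
have symE m : E m -> E (- m).
  rewrite /E /median_set/= !mass_projected => -[lm rm]; split.
    by rewrite weightN; under eq_weight do rewrite lerN2.
  by rewrite weightN; under eq_weight do rewrite lerN2.
apply/seteqP; split=> [_ [m Em <-]|m Em]; first exact: symE.
by exists (- m); [exact: symE|rewrite opprK].
Qed.

Lemma weight_split (P Q : pred R) : weight P =
  weight (fun z => P z && Q z) + weight (fun z => P z && ~~ Q z).
Proof. by rewrite /weight (bigID (fun i => Q (height i))). Qed.

Let cdf_scaled (P Q : pred R) :
  \sum_(a <- [seq (a.1, 2 * a.2) | a <- projected e mu q & P a.1] | Q a.1) a.2 =
  2 * weight (fun z => P z && Q z).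
Proof.
rewrite big_map/= big_filter_cond/= -mulr_sumr; congr (2 * _).
exact: (mass_projected (fun z => P z && Q z)).
Qed.

(** Reflection turns the lower tail into an upper one, so both halves are compared through upper
    tails: closed ones here, open ones on the right. *)
Lemma cdf_left t : cdf_of (left_distr (projected e mu q)) t =
  if 0 <= t then 1 else 2 * weight (fun z => - t <= z).
Proof.
rewrite /cdf_of /mass /left_distr/= median_projected big_cons/=.
rewrite (cdf_scaled (fun z => z < 0) (fun z => z <= t)).
rewrite -/(mass _ (fun a => a < 0)) mass_projected.
case: ifPn => t0.
  rewrite (@eq_weight (fun z => (z < 0) && (z <= t)) (fun z => z < 0)); first by field.
  by move=> z; case: (ltP z 0) => //= z0; exact: le_trans (ltW z0) t0.
rewrite [in RHS]weightN; congr (2 * _); apply: eq_weight => z.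
by rewrite lerN2; move: t0; rewrite -ltNge => t0; apply/idP/idP; lra.
Qed.

Lemma cdf_right t : cdf_of (right_distr (projected e mu q)) t =
  if 0 <= t then 1 - 2 * weight (fun z => t < z) else 0.
Proof.
rewrite /cdf_of /mass /right_distr/= median_projected big_cons/=.
rewrite (cdf_scaled (fun z => 0 < z) (fun z => z <= t)).
rewrite -/(mass _ (fun a => 0 < a)) mass_projected.
case: ifPn => t0.
  rewrite (weight_split (fun z => 0 < z) (fun z => z <= t)).
  rewrite (@eq_weight (fun z => (0 < z) && ~~ (z <= t)) (fun z => t < z)); first by field.
  move=> z; rewrite -ltNge.
  by case: (ltP t z) => tz; rewrite ?andbF// andbT; apply/idP; lra.
rewrite /weight big_pred0 ?mulr0// => i.
by move: t0; rewrite -ltNge => t0; apply/negP; lra.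
Qed.

End projection.

(** * Effect of a spread *)

Section spread.
Context {R : realType} {K : nat} (e e' : electorate R K) (mu mu' q : 'rV[R]_K).
Hypothesis e_sym : centrally_symmetric e mu.
Hypothesis e'_sym : centrally_symmetric e' mu'.
Hypothesis spread : is_spread (projected e' mu' q) (projected e mu q).

Let T t := weight e mu q (fun z => t <= z).
Let T' t := weight e' mu' q (fun z => t <= z).
Let U t := weight e mu q (fun z => t < z).
Let U' t := weight e' mu' q (fun z => t < z).

Lemma spread_weight_ge t : 0 < t -> T t <= T' t.
Proof.
move=> t0; have [/(_ (- t))] := spread.
rewrite !cdf_left// opprK [0 <= - t]lt_geF ?oppr_lt0// => H _ _.
by move: H; rewrite /T /T'; lra.
Qed.

Lemma spread_weight_gt t : 0 <= t -> U t <= U' t.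
Proof.
move=> t0; have [_ /(_ t) + _] := spread.
by rewrite !cdf_right// t0 => H; move: H; rewrite /U /U'; lra.
Qed.

(* Both step functions are constant between consecutive atoms, so a strict
   inequality at one level propagates to a whole interval below it. *)
Lemma spread_strict : exists l u : R, [/\ 0 <= l, l < u, T u < T' u &
  forall t, l < t <= u -> T t = T u /\ T' t = T' u].
Proof.
have [u u0 Tu] : exists2 u, 0 < u & T u < T' u.
  apply: contrapT => /forall2NP noT.
  have TT' u : 0 < u -> T u = T' u.
    move=> u0; apply/eqP; rewrite eq_le spread_weight_ge//= leNgt.
    by apply/negP => Tu; case: (noT u).
  (* An open tail at [t] is a closed tail at a level above [t] that no atom in between separates
     from it. *)
  have UU' t : 0 <= t -> U t = U' t.
    move=> t0; have [u1 tu1 z1] := gap_above (height e mu q) t.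
    have [u2 tu2 z2] := gap_above (height e' mu' q) t.
    pose u := Num.min u1 u2.
    have tu : t < u by rewrite lt_min tu1 tu2.
    have -> : U t = T u.
      apply: eq_bigl => i; apply/idP/idP => [/z1|]; last exact: lt_le_trans.
      by apply: le_trans; rewrite ge_min lexx.
    have -> : U' t = T' u.
      apply: eq_bigl => i; apply/idP/idP => [/z2|]; last exact: lt_le_trans.
      by apply: le_trans; rewrite ge_min lexx orbT.
    exact/TT'/(le_lt_trans t0).
  have [_ _ []] := spread; apply => t.
    rewrite !cdf_left//; case: ifPn => // t0.
    by congr (2 * _); apply: TT'; rewrite oppr_gt0 ltNge.
  rewrite !cdf_right//; case: ifPn => // t0.
  by congr (1 - 2 * _); exact/esym/UU'.
have [l1 l1u z1] := gap_below (height e mu q) u.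
have [l2 l2u z2] := gap_below (height e' mu' q) u.
exists (Num.max 0 (Num.max l1 l2)), u; split=> //.
- by rewrite le_max lexx.
- by rewrite !gt_max u0 l1u l2u.
move=> t /andP[]; rewrite !gt_max => /and3P[_ l1t l2t] tu.
split; apply: eq_bigl => i; apply/idP/idP => [|]; try exact: le_trans.
  by apply: contraTT; rewrite -!ltNge => /z1 zl; exact: le_lt_trans l1t.
by apply: contraTT; rewrite -!ltNge => /z2 zl; exact: le_lt_trans l2t.
Qed.

End spread.

(** * Sum of the two payoffs at an antipodal profile *)

Section payoff_sum.
Context {R : realType} {K : nat} {nu : R -> R} {phi : R} (phi_gt0 : 0 < phi).
Hypothesis nu_conc : strictly_concave_on 0 1 nu.
Hypothesis nu_norm : nu 1 - nu 0 = 1.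

Definition split_value (s : R) : R := nu s + nu (1 - s).

Lemma split_valueC s : split_value (1 - s) = split_value s.
Proof. by rewrite /split_value subKr addrC. Qed.

(** As [a < 1 - b], concavity makes the increment of [nu] from [a] to [b] exceed the one from
    [1 - b] to [1 - a]. *)
Lemma split_value_lt a b : 0 <= a -> a < b -> b <= 2^-1 ->
  split_value a < split_value b.
Proof.
move=> a0 ab b2.
have := strictly_concave_increment nu_conc a (1 - b) (b - a).
have -> : 1 - b + (b - a) = 1 - a by ring.
have -> : a + (b - a) = b by ring.
by rewrite /split_value; move=> H; have := H a0; lra.
Qed.

Lemma split_value_le a b : 0 <= a -> a <= b -> b <= 2^-1 ->
  split_value a <= split_value b.
Proof.
move=> a0; rewrite le_eqVlt => /predU1P[-> //|ab b2].
exact/ltW/split_value_lt.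
Qed.

Definition antipodal (mu w : 'rV[R]_K) : profile R K := (mu + w, mu - w).

(** The direction is written [2 *: w] because this is the difference of the platforms, along which
    the spread is assumed. *)
Lemma advantage_antipodal (e : electorate R K) mu w i :
  advantage (antipodal mu w) i = 2 * height e mu (2 *: w) i.
Proof.
rewrite /advantage /antipodal /height/=.
have -> : mu - w - bliss e i = - (w + (bliss e i - mu)).
  by apply/rowP => k; rewrite !mxE; ring.
have -> : mu + w - bliss e i = w - (bliss e i - mu).
  by apply/rowP => k; rewrite !mxE; ring.
by rewrite sqnormN sqnormD (sqnormB w) (dotC (bliss e i - mu)) dotZl; ring.
Qed.

Definition vote_value (e : electorate R K) mu w eps : R :=
  nu (vote_share e (antipodal mu w) PartyA eps) +
  nu (vote_share e (antipodal mu w) PartyB eps).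

Lemma integrable_vote_value e mu w :
  (shock phi_gt0).-integrable setT (EFin \o vote_value e mu w).
Proof. by apply: integrable_add; exact: integrable_votes. Qed.

Lemma expectation_vote_value e mu w :
  ('E_(shock phi_gt0)[vote_value e mu w] =
   payoff phi_gt0 nu e PartyA (antipodal mu w) +
   payoff phi_gt0 nu e PartyB (antipodal mu w))%E.
Proof. by rewrite expectation_add//; exact: integrable_votes. Qed.

(** A's share is used for positive shocks and B's, reflected, for the others: the argument is then
    an upper tail of mass at most 1/2, where [split_value] increases. *)
Lemma vote_valueE (e : electorate R K) mu w eps : centrally_symmetric e mu ->
  vote_value e mu w eps = split_value
    (if 0 < eps then weight e mu (2 *: w) (fun z => eps / 2 <= z)
     else weight e mu (2 *: w) (fun z => - (eps / 2) < z)).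
Proof.
move=> e_sym.
have vA : vote_share e (antipodal mu w) PartyA eps =
    weight e mu (2 *: w) (fun z => eps / 2 <= z).
  by apply: eq_bigl => i; rewrite advantage_antipodal ler_pdivrMr// mulrC.
rewrite /vote_value [vote_share e _ PartyB eps](_ : _ =
  1 - vote_share e (antipodal mu w) PartyA eps)// vA -/(split_value _).
case: ifPn => // eps0.
rewrite -split_valueC -weightC weightN//; congr split_value.
by apply: eq_weight => z; rewrite -ltNge ltrNl.
Qed.

(** The sum of the values weakly rises at every shock, and by the constant [c] on the interval from
    [2 * l] to [2 * u], which has positive probability. *)
Lemma spread_payoff (e e' : electorate R K) (mu mu' w : 'rV[R]_K) :
  centrally_symmetric e mu -> centrally_symmetric e' mu' ->
  (forall i, @advantage _ _ e' (antipodal mu' w) i <= phi) ->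
  is_spread (projected e' mu' (2 *: w)) (projected e mu (2 *: w)) ->
  (payoff phi_gt0 nu e PartyA (antipodal mu w) +
     payoff phi_gt0 nu e PartyB (antipodal mu w) <
   payoff phi_gt0 nu e' PartyA (antipodal mu' w) +
     payoff phi_gt0 nu e' PartyB (antipodal mu' w))%E.
Proof.
move=> e_sym e'_sym adv spread; rewrite -!expectation_vote_value.
have [l [u [l0 lu Tu const]]] := spread_strict e e' mu mu' (2 *: w) e_sym e'_sym spread.
pose T (e : electorate R K) mu t := weight e mu (2 *: w) (fun z => t <= z).
have half (e1 : electorate R K) mu1 t : centrally_symmetric e1 mu1 -> 0 < t ->
    T e1 mu1 t <= 2^-1.
  by move=> s1 t0; apply: weight_half => // z; rewrite -ltNge; lra.
have halfU (e1 : electorate R K) mu1 t : centrally_symmetric e1 mu1 -> 0 <= t ->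
    weight e1 mu1 (2 *: w) (fun z => t < z) <= 2^-1.
  by move=> s1 t0; apply: weight_half => // z; rewrite -leNgt; lra.
have u0 : 0 < u := le_lt_trans l0 lu.
(* The larger tail of [e'] contains an atom at height [u] or more, and the bound on its advantage
   keeps the interval inside the support of the shock. *)
have u_phi : 2 * u <= phi.
  have [i ui] : exists i, u <= height e' mu' (2 *: w) i.
    apply: contrapT => /forallNP no; move: Tu; rewrite ltNge => /negP; apply.
    rewrite [leLHS]/weight big_pred0 ?weight_ge0// => i.
    exact/negP/no.
  by apply: le_trans (adv i); rewrite advantage_antipodal ler_pM2l.
pose c := split_value (T e' mu' u) - split_value (T e mu u).
have c0 : 0 < c.
  rewrite subr_gt0; apply: split_value_lt => //; last exact: half.
  exact: weight_ge0.
pose bound (i : 'I_2) : R := if i == ord0 then 2 * u else 2 * l.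
pose sgn (i : 'I_2) : R := if i == ord0 then c else - c.
(* The improvement [c] on the interval, as a difference of two half-line indicators whose
   probabilities are known. *)
pose h eps := 0 + \sum_i sgn i * \1_[set t : measurableTypeR R | t <= bound i] eps.
have mh i : measurable [set t : measurableTypeR R | t <= bound i] by exact: measurable_le.
have ih : (shock phi_gt0).-integrable setT (EFin \o h) by exact: integrable_step.
have hE (eps : R) : h eps = if 2 * l < eps <= 2 * u then c else 0.
  have indE b : \1_[set t : measurableTypeR R | t <= b] eps = (eps <= b)%R%:R :> R.
    by rewrite indicE mem_setE.
  rewrite /h add0r big_ord_recl big_ord1 /sgn /bound/= !indE.
  have [le1|le1] := ltP (2 * l) eps; have [le2|le2] := leP eps (2 * u) => /=.
  - by rewrite mulr1 mulr0 addr0.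
  - by rewrite !mulr0 addr0.
  - by rewrite !mulr1 subrr.
  - by move: le1 le2 lu; lra.
have Eh : ('E_(shock phi_gt0)[h] = ((c * (u - l)) / phi)%R%:E)%E.
  rewrite expectation_step//; congr EFin.
  rewrite big_ord_recl big_ord1 /sgn /bound/= !shock_le/= !(clamp_id (ltW phi_gt0)).
  - by field; rewrite gt_eqF.
  - by rewrite ger0_norm; lra.
  - by rewrite ger0_norm; lra.
apply: (@lt_le_trans _ _ ('E_(shock phi_gt0)[vote_value e mu w] +
    'E_(shock phi_gt0)[h])%E).
  have fin : ('E_(shock phi_gt0)[vote_value e mu w] \is a fin_num)%E.
    rewrite expectation_vote_value.
    have [s ->] := payoff_value phi_gt0 nu_norm e PartyA (antipodal mu w).
    by have [s' ->] := payoff_value phi_gt0 nu_norm e PartyB (antipodal mu w).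
  by rewrite Eh lteDl// lte_fin divr_gt0// mulr_gt0// subr_gt0.
have iv := integrable_vote_value.
rewrite -expectation_add//; apply: expectation_mono => //.
  exact: integrable_add.
move=> eps; rewrite hE !vote_valueE//.
case: ltP => [eps0|eps0]; last first.
  rewrite [_ && _](_ : _ = false) ?addr0; last by apply/negP; lra.
  apply: split_value_le; [exact: weight_ge0| |apply: halfU => //; lra].
  by apply: (spread_weight_gt e e' mu mu' (2 *: w)) => //; lra.
case: ifPn => [lt_eps|_].
  have [|-> ->] := const (eps / 2); first by move: lt_eps; lra.
  by rewrite addrC subrK.
rewrite addr0; apply: split_value_le; [exact: weight_ge0| |apply: half => //; lra].
by apply: (spread_weight_ge e e' mu mu' (2 *: w)) => //; lra.
Qed.

End payoff_sum.

(** * Comparison of the two electorates *)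

Lemma composed_increasing {R : realType} {rho U nu : R -> R} :
  strictly_increasing_on 0 1 rho -> strictly_increasing_on (rho 0) (rho 1) U ->
  (forall s, s \in `[0, 1] -> nu s = U (rho s)) -> strictly_increasing_on 0 1 nu.
Proof.
move=> rho_incr U_incr nuE s t s01 t01 st; rewrite !nuE//.
have rho01 z : z \in `[0, 1] -> rho z \in `[rho 0, rho 1].
  have I0 : (0 : R) \in `[0, 1] by rewrite in_itv/= lexx ler01.
  have I1 : (1 : R) \in `[0, 1] by rewrite in_itv/= lexx ler01.
  move=> z01; rewrite in_itv/=; move: (z01); rewrite in_itv/= => /andP[z0 z1].
  apply/andP; split.
    by move: z0; rewrite le_eqVlt => /predU1P[<-//|z0]; apply/ltW/rho_incr.
  by move: z1; rewrite le_eqVlt => /predU1P[->//|z1]; apply/ltW/rho_incr.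
by apply: U_incr; rewrite ?rho01// rho_incr.
Qed.

(** In each coordinate the radius is attained by a bliss point, and its opposite by the mirror
    image; the interval of [D] contains both and all between. *)
Lemma boxed_rectangle {R : realType} {K : nat} {e : electorate R K} {mu : 'rV[R]_K}
    {D : set 'rV[R]_K} :
  centrally_symmetric e mu -> coordinate_rectangle D ->
  (forall i, D (bliss e i - mu)) -> forall z, boxed e mu z -> D z.
Proof.
move=> e_sym [I ->] De z zbox /= k.
have [i radE] := radius_attained e mu k.
have [j [yj _]] := e_sym i.
have := zbox k; rewrite radE ler_norml/=.
have yjN : (bliss e j - mu) ord0 k = - (bliss e i - mu) ord0 k.
  by rewrite yj !mxE; ring.
have := De i k; have := De j k; rewrite /= yjN.
set y := (bliss e i - mu) ord0 k => Iny Iy.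
have [y0|y0] := ger0P y.
  exact: (@interval_is_interval _ (I k) _ _ Iny Iy).
by rewrite opprK; exact: (@interval_is_interval _ (I k) _ _ Iy Iny).
Qed.

Lemma wide_support_lt {R : realType} {K : nat} {phi : R} {D : set 'rV[R]_K}
    {e : electorate R K} {mu : 'rV[R]_K} : wide_support phi D e mu ->
  forall a b, D a -> D b -> forall i,
  `|sqnorm (b - (bliss e i - mu)) - sqnorm (a - (bliss e i - mu))| < phi.
Proof.
move=> wide a b Da Db i; rewrite -lte_fin; apply: le_lt_trans (wide i).
by apply: ereal_sup_ubound; exists (a, b).
Qed.

Lemma longest_vertex {R : realType} {K : nat} (nu : R -> R) (e : electorate R K)
    (mu : 'rV[R]_K) : exists s0, forall s,
  sqnorm (vertex nu e mu s) <= sqnorm (vertex nu e mu s0).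
Proof.
pose f s := sqnorm (vertex nu e mu s).
pose id_perm : {perm 'I_(ntypes e)} := 1%g.
exists [arg max_(s > id_perm) f s]%O => s.
by case: Order.TotalTheory.arg_maxP => // s' _; exact.
Qed.

Theorem proposition7 (R : realType) (K : nat) (K_ge2 : (2 <= K)%N)
  (rho U nu : R -> R) (rhobar phi : R) (phi_gt0 : 0 < phi)
  (rho_incr : strictly_increasing_on 0 1 rho)
  (rho_sym : forall s : R, s \in `[0, 1] -> rho s + rho (1 - s) = rhobar)
  (U_cont : {within `[rho 0, rho 1], continuous U})
  (U_incr : strictly_increasing_on (rho 0) (rho 1) U)
  (U_conc : strictly_concave_on (rho 0) (rho 1) U)
  (nuE : forall s : R, s \in `[0, 1] -> nu s = U (rho s))
  (nu_norm : nu 1 - nu 0 = 1)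
  (nu_conc : strictly_concave_on 0 1 nu)
  (e e' : electorate R K) (mu mu' : 'rV[R]_K)
  (e_sym : centrally_symmetric e mu)
  (e'_sym : centrally_symmetric e' mu')
  (D : set 'rV[R]_K) (D_rect : coordinate_rectangle D)
  (D_e : forall i, D (bliss e i - mu))
  (D_e' : forall i, D (bliss e' i - mu'))
  (wide_e : wide_support phi D e mu)
  (wide_e' : wide_support phi D e' mu')
  (x : profile R K)
  (x_pp : party_preferred phi_gt0 nu e x)
  (spread : q_spread (x.1 - x.2) e' mu' e mu) :
  forall p : party, (Vhat phi_gt0 nu e p < Vhat phi_gt0 nu e' p)%E.
Proof.
have nu_incr := composed_increasing rho_incr U_incr nuE.
have boxD := boxed_rectangle e_sym D_rect D_e.
have boxD' := boxed_rectangle e'_sym D_rect D_e'.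
have narrow := wide_support_lt wide_e; have narrow' := wide_support_lt wide_e'.
have [s max_s] := longest_vertex nu e mu.
have [s' max_s'] := longest_vertex nu e' mu'.
set M := sqnorm (vertex nu e mu s) in max_s.
set M' := sqnorm (vertex nu e' mu' s') in max_s'.
move=> p.
rewrite (Vhat_best phi_gt0 nu_conc nu_norm nu_incr e mu e_sym D boxD narrow M
  max_s s)//.
rewrite (Vhat_best phi_gt0 nu_conc nu_norm nu_incr e' mu' e'_sym D boxD' narrow'
  M' max_s' s')//.
rewrite lte_fin ltrD2l ltr_pM2r ?invr_gt0 ?mulr_gt0// ltr_pM2l//.
have [] := party_preferred_antipodal phi_gt0 nu_conc nu_norm nu_incr e mu e_sym
  D boxD narrow M max_s s erefl x x_pp.
set w := position mu PartyA x => xB wM wbox payx.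
have xE : x = antipodal mu w.
  case: x @w xB {x_pp spread wM wbox payx} => xA xB /=.
  rewrite /antipodal /position/= => E; congr (_, _); first by rewrite addrC subrK.
  by rewrite -E addrC subrK.
have Dw : D w by exact: boxD.
have DNw : D (- w) by apply: boxD; exact: boxedN.
have qE : x.1 - x.2 = 2 *: w.
  by rewrite xE; apply/rowP => k; rewrite !mxE; ring.
have [_ _] := spread; rewrite qE => spr.
have shiftK z : mu' + z - mu' = z by rewrite addrC addKr.
(* The equilibrium positions of the first electorate are transplanted to the second centre; [x'] is
   only a test profile there. *)
pose x' := antipodal mu' w.
have posA : position mu' PartyA x' = w by rewrite /position/= shiftK.
have posB : position mu' PartyB x' = - w by rewrite /position/= shiftK.
have adv i : @advantage _ _ e' x' i <= phi.
  rewrite -[leLHS]/(gain e' PartyA x' i) (gainE e' mu') /= posA posB.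
  by have := narrow' _ _ Dw DNw i; rewrite ltr_norml => /andP[_ /ltW].
have := spread_payoff phi_gt0 nu_conc nu_norm e e' mu mu' w e_sym e'_sym adv spr.
rewrite -xE !payx -/x'.
have bound q : (payoff phi_gt0 nu e' q x' <=
    (nu 0 + 2^-1 + 2 * (M + M') / (2 * phi))%:E)%E.
  have [t ->] := payoff_value phi_gt0 nu_norm e' q x'.
  have Dq q1 : D (position mu' q1 x') by case: q1; rewrite ?posA ?posB.
  rewrite (value_vertex phi_gt0 nu_norm e' mu' D narrow')//.
  rewrite lee_fin lerD2l ler_pM2r ?invr_gt0 ?mulr_gt0//.
  have := sqnorm_ge0 (vertex nu e' mu' t - w).
  have := sqnorm_ge0 (vertex nu e' mu' t + w).
  have := max_s' t; rewrite sqnormB sqnormD wM.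
  by case: q => /=; rewrite posA posB ?opprK sqnormB sqnormD wM; lra.
(* Comparing the sums leaves 4 M < 2 (M + M'). *)
move=> /lt_le_trans/(_ (leeD (bound PartyA) (bound PartyB))).
rewrite -!EFinD lte_fin /best_payoff.
set c := (2 * phi)^-1 => lt_sum.
have c0 : 0 < c by rewrite invr_gt0 mulr_gt0.
by rewrite -(ltr_pM2r c0); move: lt_sum; lra.
Qed.
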